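(* Let $\mathbb K$ be a countable field, and let $\{F_n\}_{n\geq1}$ be an increasing sequence $F_1\subset F_2\subset\cdots$ of finite subsets of $\mathbb K$ with $\bigcup_nF_n=\mathbb K$ and such that $x^{-1}\in F_n$ for every $n$ and every nonzero $x\in F_n$. Let $d$ be the function on $\mathrm{ZR}(\mathbb K)\times\mathrm{ZR}(\mathbb K)$ associated with $\{F_n\}$ as defined in the context. Then: (i) the function $d$ is an ultrametric on $\mathrm{ZR}(\mathbb K)$; (ii) the topology induced by $d$ coincides with the Patch topology on $\mathrm{ZR}(\mathbb K)$. In particular it does not depend on the choice of the filtration $\{F_n\}$.
   Context: $\mathrm{ZR}(\mathbb K)$ is the set of valuations $\nu:\mathbb K\to\Gamma_\nu\cup\{\infty\}$ on $\mathbb K$ (with $\Gamma_\nu$ a totally ordered abelian group, the trivial valuation being allowed), two valuations being identified when they have the same valuation ring. The Patch topology on $\mathrm{ZR}(\mathbb K)$ is the topology generated by the sets $\mathcal O(x)=\{\nu\mid\nu(x)\geq0\}$ and $\mathcal U(x)=\{\nu\mid\nu(x)>0\}$, $x\in\mathbb K$. For $x\in\mathbb K$ set $\mathrm{ht}(x)=\min\{n\mid x\in F_n\}$. For $\nu\neq\mu$ in $\mathrm{ZR}(\mathbb K)$, $d(\nu,\mu)=\frac1n$ if for every $x\in\mathbb K$ with $\mathrm{ht}(x)<n$ both implications $\nu(x)>0\Rightarrow\mu(x)>0$ and $\nu(x)=0\Rightarrow\mu(x)=0$ hold, and there is $x\in\mathbb K$ with $\mathrm{ht}(x)=n$ for which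 one of these implications fails. Also $d(\nu,\nu)=0$. *)

(* Defs.v *)
From HB Require Import structures.
From mathcomp Require Import all_boot all_order all_algebra.
From mathcomp Require Import all_classical all_reals all_analysis.

Set Implicit Arguments.
Unset Strict Implicit.
Unset Printing Implicit Defensive.

Import Order.TTheory GRing.Theory Num.Theory.

Local Open Scope classical_set_scope.
Local Open Scope ring_scope.

(* Totally ordered abelian groups, in additive notation.  Reflexivity of the
   order follows from totality. *)
Record orderedGroup := OrderedGroup {
  og_sort :> zmodType;
  og_le : rel og_sort;
  og_le_anti : antisymmetric og_le;
  og_le_trans : transitive og_le;
  og_le_total : total og_le;
  og_leD2l : forall z x y, og_le x y -> og_le (z + x) (z + y)
}.

(* [option G] stands for the union of G and {oo}, with [None] for oo. *)
Section WithInfinity.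
Variable G : orderedGroup.
Implicit Types a b : option G.

Definition vadd a b : option G :=
  if a is Some x then if b is Some y then Some (x + y) else None else None.

Definition vle a b : bool :=
  match a, b with
  | _, None => true
  | None, Some _ => false
  | Some x, Some y => og_le x y
  end.

Definition vlt a b : bool := vle a b && (a != b).

Definition vmin a b : option G := if vle a b then a else b.

Definition vzero : option G := Some 0.

End WithInfinity.
Arguments vzero {G}.

Record valuation (K : fieldType) := Valuation {
  value_group : orderedGroup;
  vfun :> K -> option value_group;
  vfun_infty : forall x, vfun x = None <-> x = 0;
  vfunM : forall x y, vfun (x * y) = vadd (vfun x) (vfun y);
  vfunD : forall x y, vle (vmin (vfun x) (vfun y)) (vfun (x + y))
}.

Section ZariskiRiemann.
Variable K : fieldType.
Implicit Types (v w : valuation K) (x : K).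

Definition valuation_ring v : set K := [set x | vle vzero (v x)].

(* The quotient of [valuation K] by the relation "same valuation ring" is the
   image of [valuation_ring]: a class is recorded as the common ring of its
   members.  (The type [valuation K] lives in too large a universe to be a
   [choiceType], hence to be quotiented by [eq_quot].) *)
Definition ZR := {A : set K | exists v, valuation_ring v = A}.

HB.instance Definition _ := gen_eqMixin ZR.
HB.instance Definition _ := gen_choiceMixin ZR.

Definition ZR_class v : ZR :=
  exist _ (valuation_ring v) (ex_intro _ v erefl).

Lemma ZR_classP v w :
  ZR_class v = ZR_class w <-> valuation_ring v = valuation_ring w.
Proof. by split=> [[]//|e]; apply: eq_exist. Qed.

Lemma ZR_class_surj (nu : ZR) : exists v, ZR_class v = nu.
Proof. by case: nu => A [v vA]; exists v; apply: eq_exist. Qed.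

(* The sign of nu(x) for a class nu is that of v(x) for a representative v; by
   lemmas [nonneg_at_class], [pos_at_class] and [zero_at_class] below, the
   choice of the representative does not matter. *)
Definition nonneg_at (nu : ZR) x : Prop :=
  exists2 v, ZR_class v = nu & vle vzero (v x).
Definition pos_at (nu : ZR) x : Prop :=
  exists2 v, ZR_class v = nu & vlt vzero (v x).
Definition zero_at (nu : ZR) x : Prop :=
  exists2 v, ZR_class v = nu & v x = vzero.

Lemma og_le_refl (G : orderedGroup) : reflexive (@og_le G).
Proof. by move=> x; case/orP: (og_le_total x x). Qed.

Lemma vle_anti (G : orderedGroup) (a b : option G) : vle a b -> vle b a -> a = b.
Proof.
case: a b => [x|] [y|] //= xy yx; congr Some.
by apply: og_le_anti; rewrite xy yx.
Qed.

Lemma vle_refl (G : orderedGroup) (a : option G) : vle a a.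
Proof. by case: a => [x|] //=; exact: og_le_refl. Qed.

Lemma vfun1 v : v 1 = vzero.
Proof.
have := vfunM v 1 1; rewrite mulr1.
case E: (v 1) => [a|] /=; last by have /eqP := (vfun_infty v 1).1 E; rewrite oner_eq0.
case=> /eqP; rewrite -subr_eq0 opprD addrA subrr add0r oppr_eq0 => /eqP ->.
by [].
Qed.

Lemma vzero_rings v x :
  v x = vzero <-> [/\ x != 0, valuation_ring v x & valuation_ring v x^-1].
Proof.
rewrite /valuation_ring /=; split=> [vx|[x0]].
  have x0 : x != 0.
    by apply/eqP => x0; have := (vfun_infty v x).2 x0; rewrite vx.
  split=> //; first by rewrite vx; exact: og_le_refl.
  have := vfunM v x x^-1; rewrite mulfV// vfun1 vx.
  by case: (v x^-1) => [b|] //= []; rewrite add0r => <-; exact: og_le_refl.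
have := vfunM v x x^-1; rewrite mulfV// vfun1.
case: (v x) (v x^-1) => [a|] [b|] //= [] ab a0 b0; congr Some.
apply: og_le_anti; rewrite a0 andbT ab.
by have := og_leD2l a b0; rewrite addr0.
Qed.

Lemma nonneg_at_class v x : nonneg_at (ZR_class v) x <-> vle vzero (v x).
Proof.
split=> [[w /ZR_classP/(congr1 (@^~ x)) e]|]; last by exists v.
by rewrite /valuation_ring /= in e; rewrite -e.
Qed.

Lemma zero_at_class v x : zero_at (ZR_class v) x <-> v x = vzero.
Proof.
split=> [[w /ZR_classP e]|]; last by exists v.
by move=> /vzero_rings h; apply/vzero_rings; rewrite -e.
Qed.

Lemma pos_at_class v x : pos_at (ZR_class v) x <-> vlt vzero (v x).
Proof.
split=> [[w wv /andP[w0 wn0]]|]; last by exists v.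
apply/andP; split; first by apply/nonneg_at_class; exists w.
apply: contra_neq wn0 => v0; apply/esym.
have [h _] := zero_at_class w x; apply: h; rewrite wv.
exact/zero_at_class.
Qed.

(* The subbase of the Patch topology: [patch_subbase (false, x)] is O(x) and
   [patch_subbase (true, x)] is U(x).  The regular module [K^o] only serves to
   provide the pointed index type that the library requires. *)
Definition patch_subbase (i : bool * K^o) : set ZR :=
  if i.1 then [set nu | pos_at nu i.2] else [set nu | nonneg_at nu i.2].

(* [open] on [ZR K] is the Patch topology. *)
HB.instance Definition _ := isSubBaseTopological.Build ZR setT patch_subbase.

End ZariskiRiemann.

(* The sets F_n are those with n >= 1; [fil_set F 0] plays no role. *)
Record filtration (K : fieldType) := Filtration {
  fil_set :> nat -> set K;
  fil_finite : forall n, (0 < n)%N -> finite_set (fil_set n);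
  fil_incr : forall n, (0 < n)%N -> fil_set n `<=` fil_set n.+1;
  fil_cover : \bigcup_(n in [set n | (0 < n)%N]) fil_set n = setT;
  fil_inv : forall n x, (0 < n)%N -> x != 0 -> fil_set n x -> fil_set n x^-1
}.

Section Distance.
Variables (K : fieldType) (F : filtration K).
Implicit Types (nu mu : ZR K) (x : K) (n : nat).

Lemma ht_subproof x : exists n, (0 < n)%N && (x \in F n).
Proof.
have : (\bigcup_(n in [set n | (0 < n)%N]) F n) x by rewrite fil_cover.
by case=> n /= n0 Fx; exists n; rewrite n0 mem_set.
Qed.

Definition ht x : nat := ex_minn (ht_subproof x).

Definition sign_transfer nu mu x : Prop :=
  (pos_at nu x -> pos_at mu x) /\ (zero_at nu x -> zero_at mu x).

Definition first_difference nu mu : set nat :=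
  [set n | [/\ (0 < n)%N,
               forall x, (ht x < n)%N -> sign_transfer nu mu x &
               exists x, ht x = n /\ ~ sign_transfer nu mu x]].

(* [first_difference nu mu] has at most one element; were it empty for some
   nu != mu, this function would take the junk value 0^-1 = 0 there. *)
Definition ZR_dist (R : realType) nu mu : R :=
  if nu == mu then 0 else (xget 0%N (first_difference nu mu))%:R^-1.

End Distance.

Definition is_ultrametric (R : realType) (T : Type) (d : T -> T -> R) : Prop :=
  [/\ forall x y, 0 <= d x y,
      forall x y, d x y = 0 <-> x = y,
      forall x y, d x y = d y x &
      forall x y z, d x z <= Num.max (d x y) (d y z)].

Definition metric_open (R : realType) (T : Type) (d : T -> T -> R) (A : set T) :
  Prop := forall x, A x -> exists2 e : R, 0 < e & [set y | d x y < e] `<=` A.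

(* Main.v *)
Require Import Defs.
From HB Require Import structures.
From mathcomp Require Import all_boot all_order all_algebra.
From mathcomp Require Import all_classical all_reals all_analysis.

(** Everything rests on inversion.  For [x != 0] exactly one of [nu x >= 0] and
    [nu x^-1 > 0] holds, and each [F n] is stable under inversion, as is
    therefore the height.  Hence the two implications in the definition of the
    distance, required for all [x] of height [< n], amount to the symmetric
    condition that the rings of [nu] and [mu] contain the same elements of
    height [< n] ([sign_transfer_agreeP]).  This condition, [agree F n], is an
    equivalence relation that gets finer as [n] grows, trivial for [n = 1], and
    the intersection of all these relations is equality.  So for [nu != mu]
    there is a largest [n] with [agree F n nu mu], and [ZR_dist] is its inverse:
    [d nu mu <= 1 / n] iff [agree F n nu mu], for [n > 0] ([ZR_dist_leP]).
    The ultrametric axioms are then the axioms of an equivalence relation.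

    For the topologies, the classes of the relations [agree F n] form a base of
    neighbourhoods for the Patch topology as well ([nbhs_patchP]).  A class is a
    neighbourhood because [F n] is finite, and because for [x != 0] the
    complement of [O(x)] is the subbasic set [U(x^-1)]; and a finite
    intersection of subbasic sets only involves elements of bounded height, so
    it is a union of classes of [agree F n] as soon as [n] exceeds this bound. *)

Set Implicit Arguments.
Unset Strict Implicit.
Unset Printing Implicit Defensive.

Import Order.TTheory GRing.Theory Num.Theory.

Local Open Scope classical_set_scope.
Local Open Scope ring_scope.

(** * Signs of a valuation class *)

Section Signs.
Variable K : fieldType.
Implicit Types (nu mu : ZR K) (x : K).

Lemma pos_atE nu x : pos_at nu x <-> nonneg_at nu x /\ ~ zero_at nu x.
Proof.
have [v <-] := ZR_class_surj nu; split.
  move=> /pos_at_class /andP[v0 /eqP vn0].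
  by split; [apply/nonneg_at_class | move=> /zero_at_class e; apply: vn0].
move=> [/nonneg_at_class v0 vn0]; apply/pos_at_class; rewrite /vlt v0 /=.
by apply/eqP => e; apply: vn0; apply/zero_at_class.
Qed.

Lemma pos_nonneg_at nu x : pos_at nu x -> nonneg_at nu x.
Proof. by move=> /pos_atE[]. Qed.

Lemma zero_atE nu x :
  zero_at nu x <-> [/\ x != 0, nonneg_at nu x & nonneg_at nu x^-1].
Proof.
have [v <-] := ZR_class_surj nu; split.
  by move=> /zero_at_class/vzero_rings[? ? ?]; split=> //;
    apply/nonneg_at_class.
move=> [x0 /nonneg_at_class ? /nonneg_at_class ?].
by apply/zero_at_class/vzero_rings.
Qed.

Lemma pos_at0 nu : pos_at nu 0.
Proof.
have [v <-] := ZR_class_surj nu; apply/pos_at_class.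
by rewrite /vlt; have -> : v 0 = None by apply/vfun_infty.
Qed.

(** Since [nu x + nu x^-1 = 0] in a totally ordered group, [nu x < 0] is the
    same as [nu x^-1 > 0]. *)
Lemma not_nonneg_atE nu x :
  x != 0 -> (~ nonneg_at nu x <-> pos_at nu x^-1).
Proof.
move=> x0; have [v <-] := ZR_class_surj nu.
rewrite pos_atE zero_atE invrK invr_eq0; split; last first.
  by move=> [? nz] ?; apply: nz.
move=> nx; split; last by case.
apply/nonneg_at_class; move: nx => /nonneg_at_class.
have := vfunM v x x^-1; rewrite mulfV// vfun1.
case: (v x) (v x^-1) => [a|] [b|] //= [] ab /negP na.
have : og_le a 0 by have := og_le_total a 0; rewrite (negPf na) orbF.
by move=> /(og_leD2l b); rewrite addr0 addrC -ab.
Qed.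

Lemma ZR_ext nu mu : (forall x, nonneg_at nu x <-> nonneg_at mu x) -> nu = mu.
Proof.
have [[v <-] [w <-]] := (ZR_class_surj nu, ZR_class_surj mu) => vw.
by apply/ZR_classP/seteqP; split=> x /nonneg_at_class/vw/nonneg_at_class.
Qed.

End Signs.

(** * Agreement up to a height *)

Section Agreement.
Variables (K : fieldType) (F : filtration K).
Implicit Types (nu mu : ZR K) (x : K) (n m : nat).

Lemma ht_gt0 x : (0 < ht F x)%N.
Proof. by rewrite /ht; case: ex_minnP => n /andP[]. Qed.

Lemma fil_ht x : F (ht F x) x.
Proof. by rewrite /ht; case: ex_minnP => n /andP[_ /set_mem]. Qed.

Lemma ht_min n x : (0 < n)%N -> F n x -> (ht F x <= n)%N.
Proof.
move=> n0 Fx; rewrite /ht; case: ex_minnP => m _; apply.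
by rewrite n0 mem_set.
Qed.

Lemma ht_fil n x : (ht F x <= n)%N -> F n x.
Proof.
move=> /subnK <-; elim: (n - _)%N => [|k IH]; first exact: fil_ht.
by rewrite addSn; apply: fil_incr => //; rewrite ltn_addl// ht_gt0.
Qed.

Lemma ht_inv x : x != 0 -> (ht F x^-1 <= ht F x)%N.
Proof.
by move=> x0; apply: ht_min; [exact: ht_gt0 | apply: fil_inv => //;
  [exact: ht_gt0 | exact: fil_ht]].
Qed.

Definition agree n nu mu : Prop :=
  forall x, (ht F x < n)%N -> (nonneg_at nu x <-> nonneg_at mu x).

Lemma agree_sym n nu mu : agree n nu mu -> agree n mu nu.
Proof. by move=> h x /h[]. Qed.

Lemma agree_trans n la nu mu : agree n la nu -> agree n nu mu -> agree n la mu.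
Proof. by move=> h h' x xn; rewrite h// h'. Qed.

Lemma agree_le m n nu mu : (m <= n)%N -> agree n nu mu -> agree m nu mu.
Proof. by move=> mn h x xm; apply: h; apply: leq_trans mn. Qed.

Lemma agree1 nu mu : agree 1 nu mu.
Proof. by move=> x; rewrite ltnS leqNgt ht_gt0. Qed.

Lemma agree_eq nu mu : (forall n, agree n nu mu) -> nu = mu.
Proof. by move=> h; apply: ZR_ext => x; apply: (h (ht F x).+1). Qed.

(** The one-sided sign conditions are symmetric when taken together: if
    [nu x < 0], the condition at [x^-1], whose height is the same, gives
    [mu x < 0]. *)
Lemma sign_transfer_agreeP n nu mu :
  (forall x, (ht F x < n)%N -> sign_transfer nu mu x) <-> agree n nu mu.
Proof.
split=> h x xn.
  split=> [nux|mux].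
    have [[hp hz] [/hz z|nz]] := (h x xn, pselect (zero_at nu x)).
      by have /zero_atE[] := z.
    by apply/pos_nonneg_at/hp/pos_atE.
  have [->|x0] := eqVneq x 0; first exact/pos_nonneg_at/pos_at0.
  apply: contrapT => /(not_nonneg_atE _ x0) pnu.
  have [hp _] := h x^-1 (leq_ltn_trans (ht_inv x0) xn).
  by have /(not_nonneg_atE _ x0) := hp pnu.
have [->|x0] := eqVneq x 0.
  by split=> [_|/zero_atE[/eqP]]; first exact: pos_at0.
have xVn := leq_ltn_trans (ht_inv x0) xn.
have xV0 : x^-1 != 0 by rewrite invr_eq0.
split; last first.
  by move=> /zero_atE[_ /(h _ xn) a /(h _ xVn) b]; apply/zero_atE.
rewrite -{1 2}(invrK x) => /(not_nonneg_atE _ xV0) nnu.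
by apply/(not_nonneg_atE _ xV0); rewrite -h.
Qed.

Lemma first_differenceE nu mu n :
  first_difference F nu mu n <->
  [/\ (0 < n)%N, agree n nu mu & ~ agree n.+1 nu mu].
Proof.
split=> [[n0 /sign_transfer_agreeP an [x [xn nx]]]|].
  split=> // /sign_transfer_agreeP; move=> /(_ x); rewrite xn => /(_ (ltnSn n)).
  exact: nx.
move=> [n0 /sign_transfer_agreeP an nan]; split => //.
apply: contrapT => /forallNP nx; apply: nan; apply/sign_transfer_agreeP => x.
rewrite ltnS leq_eqVlt => /orP[/eqP xn|/an//].
by apply: contrapT => nt; apply: (nx x).
Qed.

End Agreement.

(** * The distance *)

Section Distance.
Variables (R : realType) (K : fieldType) (F : filtration K).
Implicit Types (nu mu : ZR K) (n m : nat).
Local Notation d := (ZR_dist F R).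

Lemma ZR_distxx nu : d nu nu = 0.
Proof. by rewrite /ZR_dist eqxx. Qed.

(** The last index of agreement exists: two distinct classes disagree from some
    index on, but not at index [1]. *)
Lemma ZR_dist_neq nu mu : nu <> mu ->
  exists n, [/\ (0 < n)%N, agree F n nu mu, ~ agree F n.+1 nu mu &
                d nu mu = n%:R^-1].
Proof.
move=> /eqP ne.
have ex : exists n, ~~ `[< agree F n nu mu >].
  apply: contrapT => /forallNP h; move/eqP: ne; apply; apply: (@agree_eq _ F).
  by move=> n; apply: contrapT => /asboolPn nn; apply: (h n).
have fd : exists n, first_difference F nu mu n.
  case: (ex_minnP ex) => -[|[|n]] /asboolPn nan nmin.
  - by case: nan.
  - by case: nan; exact: agree1.
  exists n.+1; apply/first_differenceE; split => //.
  by apply: contrapT => /asboolPn/nmin; rewrite ltnn.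
rewrite /ZR_dist (negPf ne); case: xgetP => [n _ /first_differenceE[]|h].
  by move=> n0 an nan; exists n.
by case: fd => n /h.
Qed.

Lemma ZR_dist_ge0 nu mu : 0 <= d nu mu.
Proof. by rewrite /ZR_dist; case: ifP => // _; rewrite invr_ge0. Qed.

Lemma ZR_dist_leP n nu mu :
  (0 < n)%N -> (d nu mu <= n%:R^-1) <-> agree F n nu mu.
Proof.
move=> n0; have [->|/ZR_dist_neq[k [k0 ak nak ->]]] := pselect (nu = mu).
  by rewrite ZR_distxx invr_ge0 ler0n.
rewrite lef_pV2 ?posrE ?ltr0n// ler_nat; split=> [nk|an].
  exact: agree_le ak.
by rewrite leqNgt; apply/negP => kn; apply/nak/(agree_le kn).
Qed.

Lemma ZR_dist_eq0 nu mu : d nu mu = 0 <-> nu = mu.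
Proof.
split=> [d0|->]; last exact: ZR_distxx.
apply: contrapT => /ZR_dist_neq[n [n0 _ _ dn]]; move/eqP: d0.
by rewrite dn invr_eq0 pnatr_eq0 eqn0Ngt n0.
Qed.

Lemma ZR_dist_sym nu mu : d nu mu = d mu nu.
Proof.
suff le la ka : d la ka <= d ka la by apply: le_anti; rewrite !le.
have [->//|/ZR_dist_neq[n [n0 an _ ->]]] := pselect (ka = la).
exact/ZR_dist_leP/agree_sym.
Qed.

Lemma ZR_dist_ultra la nu mu : d la mu <= Num.max (d la nu) (d nu mu).
Proof.
have [->|ne1] := pselect (la = nu); first by rewrite le_max lexx orbT.
have [->|ne2] := pselect (nu = mu); first by rewrite le_max lexx.
have [n [n0 an _ dn]] := ZR_dist_neq ne1.
have [m [m0 am _ dm]] := ZR_dist_neq ne2.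
rewrite le_max dn dm; apply/orP; have [nm|/ltnW mn] := leqP n m; [left|right].
  by apply/ZR_dist_leP => //; apply: agree_trans an (agree_le nm am).
by apply/ZR_dist_leP => //; apply: agree_trans (agree_le mn an) am.
Qed.

Lemma ZR_dist_ultrametric : is_ultrametric d.
Proof.
split; [exact: ZR_dist_ge0|exact: ZR_dist_eq0|exact: ZR_dist_sym|].
by move=> la nu mu; exact: ZR_dist_ultra.
Qed.

Lemma metric_openP (A : set (ZR K)) :
  metric_open d A <->
  forall nu, A nu -> exists n, agree F n nu `<=` A.
Proof.
split=> mA nu Anu.
  have [e e0 eA] := mA nu Anu.
  have [n ne] : exists n, n.+1%:R^-1 < e.
    by exists (Num.truncn e^-1); rewrite invf_plt ?posrE// truncnS_gt.
  by exists n.+1 => mu amu; apply/eA/(le_lt_trans _ ne)/ZR_dist_leP.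
have [n nA] := mA nu Anu.
exists n.+1%:R^-1; first by rewrite invr_gt0 ltr0n.
move=> mu /= /ltW/ZR_dist_leP => /(_ (ltn0Sn n)) amu.
exact/nA/(agree_le (leqnSn n)).
Qed.

End Distance.

(** * The Patch topology *)

Section Patch.
Variables (K : fieldType) (F : filtration K).
Implicit Types (nu mu : ZR K) (n : nat).

Lemma open_patchE (A : set (ZR K)) :
  open A = exists2 D', D' `<=` finI_from setT (@patch_subbase K) &
                       \bigcup_(B in D') B = A.
Proof. by []. Qed.

Lemma open_patch_subbase (i : bool * K^o) : open (@patch_subbase K i).
Proof.
rewrite open_patchE; exists [set patch_subbase i]; last by rewrite bigcup_set1.
by move=> _ ->; apply: finI_from1.
Qed.

(** [O(x)] is closed as well as open: its complement is empty or [U(x^-1)]. *)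
Lemma nbhs_same_sign nu (x : K) :
  nbhs nu [set mu | nonneg_at nu x <-> nonneg_at mu x].
Proof.
have [nux|nnux] := pselect (nonneg_at nu x).
  have := open_nbhs_nbhs (conj (open_patch_subbase (false, x)) nux).
  by apply: filterS => mu mux; split.
have x0 : x != 0.
  by apply/eqP => x0; apply: nnux; rewrite x0; exact/pos_nonneg_at/pos_at0.
have /(not_nonneg_atE _ x0) pnu := nnux.
have := open_nbhs_nbhs (conj (open_patch_subbase (true, x^-1)) pnu).
by apply: filterS => mu /= /(not_nonneg_atE _ x0) mux; split.
Qed.

Lemma patch_subbase_agree (i : bool * K^o) n nu mu :
  (ht F i.2 < n)%N -> agree F n nu mu ->
  patch_subbase i nu -> patch_subbase i mu.
Proof.
case: i => -[] x /= xn a.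
  by have /sign_transfer_agreeP/(_ x xn)[] := a.
by move/a => /(_ xn).
Qed.

Lemma nbhs_patchP nu (A : set (ZR K)) :
  nbhs nu A <-> exists n, agree F n nu `<=` A.
Proof.
split=> [|[n nA]].
  rewrite nbhsE => -[U [+ Unu] UA]; rewrite open_patchE => -[D' sD' D'U].
  move: Unu; rewrite -D'U => -[B D'B Bnu]; have [J _ JB] := sD' _ D'B.
  exists (\max_(i <- finmap.enum_fset J) (ht F i.2).+1)%N => mu amu; apply: UA.
  rewrite -D'U; exists B => //.
  move: Bnu; rewrite -JB => Jnu i /= iJ.
  apply: patch_subbase_agree amu (Jnu i iJ).
  exact: (leq_bigmax_seq i iJ).
apply: (filterS nA); case: n {nA} => [|n]; first exact: filterE.
have /finite_fsetP[J FJ] := fil_finite F (ltn0Sn n).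
pose P x := [set mu | nonneg_at nu x <-> nonneg_at mu x].
have := filter_bigI (D := J) (f := P) (nbhs_filter nu)
  (fun x _ => nbhs_same_sign nu x).
by rewrite -FJ; apply: filterS => mu h x xn; apply: (h x); exact/ht_fil/ltnW.
Qed.

Lemma metric_open_patch (R : realType) (A : set (ZR K)) :
  metric_open (ZR_dist F R) A <-> open A.
Proof.
rewrite metric_openP openE /interior.
by split=> mA nu /mA /nbhs_patchP.
Qed.

End Patch.

Theorem theorem4p38 (R : realType) (K : fieldType)
    (countableK : countable [set: K]) (F : filtration K) :
  is_ultrametric (ZR_dist F R) /\
  (forall A : set (ZR K), metric_open (ZR_dist F R) A <-> open A) /\
  (forall (F' : filtration K) (A : set (ZR K)),
    metric_open (ZR_dist F R) A <-> metric_open (ZR_dist F' R) A).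
Proof.
split; first exact: ZR_dist_ultrametric.
split=> [A|F' A]; first exact: metric_open_patch.
by rewrite !metric_open_patch.
Qed.
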